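(* Fix $d\in\mathbb{N}^+$, $\epsilon_c>0$, $\delta\in(0,0.5]$, and let $\mathbb{X}=\{x\in\mathbb{R}^d:\|x\|_2\le 1\}$. Then for any randomizer $\mathcal{R}:\mathbb{X}\to\mathbb{R}^{d'}$ such that $\mathcal{S}\circ\mathcal{R}(X)$ and $\mathcal{S}\circ\mathcal{R}(X')$ are $(\epsilon_c,\delta)$-indistinguishable for all neighboring datasets $X,X'\in\mathbb{X}^n$, and for any estimator $f:\mathbb{R}^{d'}\to\mathbb{R}^d$, $$\max_{x\in\mathbb{X}}\mathbb{E}\big[\|f\circ\mathcal{R}(x)-x\|_2^2\big]\ \ge\ \tilde{\Omega}\big(1/n^{\frac{2}{d+2}}\big).$$
   Context: A randomizer $\mathcal{R}:\mathbb{X}\to\mathbb{R}^{d'}$ is a randomized map ($d'\ge1$ an arbitrary integer). For $X=(x_1,\dots,x_n)\in\mathbb{X}^n$, $\mathcal{S}\circ\mathcal{R}(X)=\mathcal{S}(\mathcal{R}(x_1),\dots,\mathcal{R}(x_n))$, where $\mathcal{R}$ is applied with independent randomness to each entry and the shuffler $\mathcal{S}$ applies a uniformly random permutation to its $n$ inputs. Neighboring datasets are datasets of the same size $n$ differing in only one element. Two random variables with laws $P,Q$ are $(\epsilon_c,\delta)$-indistinguishable if $\max(D_{\epsilon_c}(P\|Q),D_{\epsilon_c}(Q\|P))\le\delta$, where $D_\epsilon(P\|Q)=\int\max\{0,P(z)-e^\epsilon Q(z)\}\,dz$. Asymptotics are in $n\to\infty$ with $d,\epsilon_c,\delta$ fixed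 (independent of $n$): $\tilde\Omega(g(n))$ means at least $c\,g(n)/(\log n)^k$ for all $n\ge n_0$, with constants $c>0$, $k\ge0$, $n_0$ depending only on $d,\epsilon_c,\delta$ (and not on $\mathcal{R}$, $d'$ or $f$). The maximum over $x$ is to be read as a supremum. *)

(* Defs.v *)
From HB Require Import structures.
From mathcomp Require Import all_boot all_order all_fingroup all_algebra.
From mathcomp Require Import all_classical all_reals all_analysis.

Set Implicit Arguments.
Unset Strict Implicit.
Unset Printing Implicit Defensive.
Import Order.TTheory GRing.Theory Num.Theory.
Import numFieldNormedType.Exports.

Local Open Scope classical_set_scope.
Local Open Scope ring_scope.

(* R^d is [d.-tuple R]: the library equips it with the product sigma-algebra,
   here the Borel one. *)

Definition l2norm (R : realType) (d : nat) (x : d.-tuple R) : R :=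
  Num.sqrt (\sum_(i < d) tnth x i ^+ 2).

Definition vsub (R : realType) (d : nat) (x y : d.-tuple R) : d.-tuple R :=
  [tuple tnth x i - tnth y i | i < d].

Definition unit_ball (R : realType) (d : nat) : Type :=
  {x : d.-tuple R | l2norm x <= 1}.

Section product_law.
Context (disp : measure_display) (T : measurableType disp) (R : realType).

Definition tuple_cons (n : nat) (z : T * n.-tuple T) : n.+1.-tuple T :=
  [tuple of z.1 :: z.2].

Lemma measurable_tuple_cons (n : nat) : measurable_fun setT (@tuple_cons n).
Proof. exact: measurable_cons. Qed.

HB.instance Definition _ (n : nat) :=
  isMeasurableFun.Build _ _ _ _ (@tuple_cons n) (@measurable_tuple_cons n).

(* Joint law of independent random variables with laws P_0, ..., P_(n-1). *)
Fixpoint product_law (n : nat) :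
    ('I_n -> probability T R) -> probability (n.-tuple T) R :=
  match n with
  | 0 => fun _ => \d_([tuple])
  | m.+1 => fun P =>
      distribution (P ord0 \x product_law (fun i => P (lift ord0 i)))%E
        (@tuple_cons m)
  end.

End product_law.

Section shuffle.
Context (disp : measure_display) (T : measurableType disp) (R : realType).

Definition permute (n : nat) (s : 'S_n) (t : n.-tuple T) : n.-tuple T :=
  [tuple tnth t (s i) | i < n].

Lemma measurable_permute (n : nat) (s : 'S_n) :
  measurable_fun setT (permute s).
Proof.
apply/measurable_fun_tnthP => i.
rewrite (_ : _ \o _ = fun t => tnth t (s i)); first exact: measurable_tnth.
by apply/funext => t /=; rewrite tnth_mktuple.
Qed.

HB.instance Definition _ (n : nat) (s : 'S_n) :=
  isMeasurableFun.Build _ _ _ _ (permute s) (@measurable_permute n s).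

Local Open Scope ereal_scope.

(* Law of the output of the shuffler on inputs of joint law P, the permutation
   being uniform and independent of the inputs. *)
Definition shuffle (n : nat) (P : probability (n.-tuple T) R)
    (A : set (n.-tuple T)) : \bar R :=
  ((n`!)%:R^-1)%:E * \sum_(s : 'S_n) distribution P (permute s) A.

Variables (n : nat) (P : probability (n.-tuple T) R).

Let shuffle0 : shuffle P set0 = 0.
Proof. by rewrite /shuffle big1 ?mule0. Qed.

Let shuffle_ge0 A : 0 <= shuffle P A.
Proof.
by apply: mule_ge0; [rewrite lee_fin invr_ge0|apply: sume_ge0 => s _].
Qed.

Let shuffle_sigma_additive : semi_sigma_additive (shuffle P).
Proof.
move=> F mF tF mUF; rewrite /shuffle.
rewrite [X in X @ _ --> _](_ : _ = (fun k => ((n`!)%:R^-1)%:E *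
   \sum_(s : 'S_n) \sum_(0 <= i < k) distribution P (permute s) (F i))).
  apply: cvgeZl => //; apply: cvg_nnesum.
    by move=> s _; apply: nearW => k; exact: sume_ge0.
  by move=> s _; exact: measure_semi_sigma_additive.
apply/funext => k; rewrite exchange_big/= ge0_sume_distrr// => i _.
exact: sume_ge0.
Qed.

HB.instance Definition _ := isMeasure.Build _ _ _ (shuffle P)
  shuffle0 shuffle_ge0 shuffle_sigma_additive.

Let shuffle_setT : shuffle P setT = 1.
Proof.
rewrite /shuffle (eq_bigr (fun=> 1)); last first.
  by move=> s _; exact: probability_setT.
rewrite sumEFin big_const iter_addr addr0 card_Sn -EFinM mulVf//.
Qed.

HB.instance Definition _ :=
  Measure_isProbability.Build _ _ _ (shuffle P) shuffle_setT.

End shuffle.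

Definition shuffled_law (disp : measure_display) (T : measurableType disp)
    (R : realType) (X : Type) (n : nat) (rand : X -> probability T R)
    (x : n.-tuple X) : probability (n.-tuple T) R :=
  shuffle (product_law (fun i => rand (tnth x i))).

Definition neighboring (X : eqType) (n : nat) (x y : n.-tuple X) : Prop :=
  #|[pred i | tnth x i != tnth y i]| = 1%N.

Section indistinguishability.
Context (disp : measure_display) (T : measurableType disp) (R : realType).
Implicit Types P Q : probability T R.
Local Open Scope ereal_scope.
Local Open Scope charge_scope.

Definition sum_law P Q : set T -> \bar R := measure_add P Q.

HB.instance Definition _ P Q := Measure.copy (sum_law P Q) (measure_add P Q).

Let sum_law_fin P Q : fin_num_fun (sum_law P Q).
Proof.
by move=> A mA; rewrite /sum_law measure_addE fin_numD !fin_num_measure.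
Qed.

HB.instance Definition _ P Q :=
  Measure_isFinite.Build _ _ _ (sum_law P Q) (@sum_law_fin P Q).

(* Densities are taken with respect to P + Q, which dominates both laws; the
   integral does not depend on the choice of the dominating measure. *)
Definition hockey_stick (eps : R) P Q : \bar R :=
  let mu := sum_law P Q in
  let p := 'd (charge_of_finite_measure P) '/d mu in
  let q := 'd (charge_of_finite_measure Q) '/d mu in
  \int[mu]_z maxe 0 (p z - (expR eps)%:E * q z).

Definition indistinguishable (eps delta : R) P Q : Prop :=
  maxe (hockey_stick eps P Q) (hockey_stick eps Q P) <= delta%:E.

End indistinguishability.

Definition sup_mse (R : realType) (d d' : nat)
    (rand : unit_ball R d -> probability (d'.-tuple R) R)
    (f : d'.-tuple R -> d.-tuple R) : \bar R :=
  ereal_sup [set ('E_(rand x)[(fun z => l2norm (vsub (f z) (val x)) ^+ 2)%R])%E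
            | x in [set: unit_ball R d]].

(* Main.v *)
(* Let a be the supremum of the mean squared errors, and place a grid of m^d
   points, of mesh of order 1/m, in the ball and away from the origin, each with
   its own box; the boxes are disjoint. On input 0 the estimate falls in some box
   with probability O(a), so the average box is hit with probability
   O(a / m^d); on the grid point g as input, its box is hit with probability at
   least 1 - O(a m^2). Compare the dataset of n zeros with the one where a single
   entry is g, through the permutation-invariant event that some report is
   estimated in the box of g: the union bound on one side and a single marginal on the
   other give 1 - O(a m^2) <= e^eps n O(a / m^d) + delta after averaging over g.
   Since delta <= 1/2 this reads 1 <= O(a (m^2 + n / m^d)), and m of order
   n^(1/(d+2)) gives the bound, without any logarithmic loss. *)

Require Import Defs.
From mathcomp Require Import all_boot all_order all_fingroup all_algebra.
From mathcomp Require Import all_classical all_reals all_analysis.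
From mathcomp Require Import measurable_realfun lra.

Set Implicit Arguments.
Unset Strict Implicit.
Unset Printing Implicit Defensive.
Import Order.TTheory GRing.Theory Num.Theory.
Import numFieldNormedType.Exports.

Local Open Scope classical_set_scope.
Local Open Scope ring_scope.

(** * Hockey-stick divergence tested on events *)

Section hockey.
Context (disp : measure_display) (T : measurableType disp) (R : realType).
Implicit Types P Q : probability T R.
Local Open Scope ereal_scope.
Local Open Scope charge_scope.

(** With densities [p], [q] with respect to P + Q, the gap between the two masses of [A] is the
    integral over [A] of p - e^eps q. It can only grow when the integrand is replaced by its
    positive part and then [A] by the whole space. *)
Lemma hockey_stick_bound (eps : R) P Q (A : set T) : measurable A ->
  P A <= (expR eps)%:E * Q A + hockey_stick eps P Q.
Proof.
move=> mA; rewrite /hockey_stick.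
set mu := sum_law P Q.
have muE B : sum_law P Q B = P B + Q B by rewrite /sum_law measure_addE.
have Pmu : charge_of_finite_measure P `<< mu.
  apply/null_content_dominatesP => B mB /(etrans (esym (muE B)))/eqP.
  by rewrite padde_eq0 // => /andP[/eqP].
have Qmu : charge_of_finite_measure Q `<< mu.
  apply/null_content_dominatesP => B mB /(etrans (esym (muE B)))/eqP.
  by rewrite padde_eq0 // => /andP[_ /eqP].
set p := 'd _ '/d _; set q := 'd _ '/d _.
have ip : mu.-integrable setT p by exact: Radon_Nikodym_integrable.
have iq : mu.-integrable setT q by exact: Radon_Nikodym_integrable.
have icq : mu.-integrable setT (fun x => (expR eps)%:E * q x).
  exact: integrableZl.
have id : mu.-integrable setT (fun x => p x - (expR eps)%:E * q x).
  exact: integrableB.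
have ih : mu.-integrable setT (fun x => maxe 0 (p x - (expR eps)%:E * q x)).
  rewrite (_ : (fun x => maxe _ _) =
      (fun x => p x - (expR eps)%:E * q x)^\+).
    exact: integrable_funepos.
  by apply/funext => x; rewrite funeposE maxC.
have iA g : mu.-integrable setT g -> mu.-integrable A g.
  by apply: integrableS.
rewrite -leeBlDl ?fin_numM ?fin_num_measure//.
have -> : P A = \int[mu]_(x in A) p x by exact: (Radon_Nikodym_integral Pmu).
have -> : Q A = \int[mu]_(x in A) q x by exact: (Radon_Nikodym_integral Qmu).
rewrite -integralZl//; last exact: iA.
rewrite -integralB//; [|exact: iA..].
apply: (@le_trans _ _
  (\int[mu]_(x in A) maxe 0 (p x - (expR eps)%:E * q x))); last first.
  rewrite ge0_subset_integral//.
  - exact: (measurable_int mu ih).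
  - by move=> x _; rewrite le_max lexx.
apply: le_integral => //; [exact: iA..|].
by move=> x _ /=; rewrite le_max lexx orbT.
Qed.
End hockey.

(** * Product laws, the shuffler and permutation-invariant events *)

Lemma measure_bigsetU_le (disp : measure_display) (T : measurableType disp)
    (R : realType) (mu : {measure set T -> \bar R}) (I : Type) (r : seq I)
    (F : I -> set T) : (forall i, measurable (F i)) ->
  (mu (\big[setU/set0]_(i <- r) F i) <= \sum_(i <- r) mu (F i))%E.
Proof.
move=> mF; elim: r => [|i r IH]; first by rewrite !big_nil measure0.
rewrite !big_cons; apply: le_trans (leeD2l _ IH).
by apply: measureU2 => //; exact: bigsetU_measurable.
Qed.

Section product.
Context (disp : measure_display) (T : measurableType disp) (R : realType).
Local Open Scope ereal_scope.

Lemma measurable_tnth_preimage (n : nat) (i : 'I_n) (A : set T) :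
  measurable A -> measurable [set t : n.-tuple T | A (tnth t i)].
Proof.
move=> mA; rewrite -[X in measurable X]setTI.
exact: (@measurable_tnth _ _ n i measurableT A).
Qed.

(** Peeling off the head turns the event into a rectangle with one full side, of mass 1. *)
Lemma product_law_marginal (n : nat) (P : 'I_n -> probability T R) (i : 'I_n)
    (A : set T) : measurable A ->
  product_law P [set t | A (tnth t i)] = P i A.
Proof.
move=> mA; elim: n P i => [|n IH] P i; first by case: i.
rewrite /= /distribution /pushforward.
case: (unliftP ord0 i) => [j ->|->].
  rewrite (_ : _ @^-1` _ = setT `*` [set t : n.-tuple T | A (tnth t j)]).
    rewrite product_measure1E//; last exact: measurable_tnth_preimage.
    rewrite [X in X * _](_ : _ = 1) ?mul1e; last exact: probability_setT.
    exact: (IH (fun i => P (lift ord0 i)) j).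
  apply/seteqP; split => -[x t] /=.
    by rewrite tnthS.
  by move=> [_]; rewrite tnthS.
rewrite (_ : _ @^-1` _ = A `*` setT).
  rewrite product_measure1E//.
  by rewrite [X in _ * X](_ : _ = 1) ?mule1 //; exact: probability_setT.
apply/seteqP; split => -[x t] /=.
  by rewrite tnth0.
by move=> [+ _]; rewrite tnth0.
Qed.

Lemma shuffle_invariant (n : nat) (P : probability (n.-tuple T) R)
    (A : set (n.-tuple T)) : measurable A ->
  (forall s : 'S_n, permute s @^-1` A = A) -> shuffle P A = P A.
Proof.
move=> mA sA; rewrite /shuffle (eq_bigr (fun=> (fine (P A))%:E)); last first.
  move=> s _.
  by rewrite /distribution /pushforward /= sA fineK ?fin_num_measure.
rewrite sumEFin sumr_const card_Sn -EFinM -(mulr_natl (fine _)).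
rewrite mulrA mulVf ?mul1r.
  by rewrite fineK ?fin_num_measure.
by rewrite pnatr_eq0 -lt0n fact_gt0.
Qed.

(** As a finite union, the event is open to the union bound and to closure of measurability. *)
Definition some_report (n : nat) (B : set T) : set (n.-tuple T) :=
  \big[setU/set0]_(i < n) [set t | B (tnth t i)].

Lemma some_reportE (n : nat) (B : set T) :
  some_report B = [set t : n.-tuple T | exists i, B (tnth t i)].
Proof.
rewrite /some_report -bigcup_seq; apply/seteqP; split => t /=.
  by move=> [i _]; exists i.
by move=> [i Bi]; exists i => //=; rewrite mem_index_enum.
Qed.

Lemma measurable_some_report (n : nat) (B : set T) :
  measurable B -> measurable (some_report B : set (n.-tuple T)).
Proof.
by move=> mB; apply: bigsetU_measurable => i _; exact: measurable_tnth_preimage.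
Qed.

Lemma shuffle_some_report (n : nat) (P : probability (n.-tuple T) R)
    (B : set T) : measurable B ->
  shuffle P (some_report B) = P (some_report B).
Proof.
move=> mB; apply: shuffle_invariant => [|s].
  exact: measurable_some_report.
rewrite some_reportE.
apply/seteqP; split => t /= [i].
  by rewrite tnth_mktuple => Bi; exists (s i).
by move=> Bi; exists (perm.fun_of_perm s^-1%g i); rewrite tnth_mktuple permKV.
Qed.

Lemma shuffled_law_some_report_le (X : Type) (n : nat)
    (rand : X -> probability T R) (x : n.-tuple X) (B : set T) :
  measurable B ->
  shuffled_law rand x (some_report B) <= \sum_(i < n) rand (tnth x i) B.
Proof.
move=> mB; rewrite [leLHS]shuffle_some_report//.
under eq_bigr do rewrite -(product_law_marginal (fun i => rand (tnth x i)))//.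
apply: measure_bigsetU_le => i; exact: measurable_tnth_preimage.
Qed.

Lemma shuffled_law_some_report_ge (X : Type) (n : nat)
    (rand : X -> probability T R) (x : n.-tuple X) (i : 'I_n) (B : set T) :
  measurable B ->
  rand (tnth x i) B <= shuffled_law rand x (some_report B).
Proof.
move=> mB; rewrite [leRHS]shuffle_some_report//.
rewrite -(product_law_marginal (fun i => rand (tnth x i)))//.
apply: le_measure; rewrite ?inE.
- exact: measurable_tnth_preimage.
- exact: measurable_some_report.
- by rewrite some_reportE => t /= Bt; exists i.
Qed.
End product.

(** * Markov-type inequalities *)

Section expectation_lower_bound.
Context (disp : measure_display) (T : measurableType disp) (R : realType).
Variables (P : probability T R) (g : T -> R).
Hypotheses (mg : measurable_fun setT g) (g0 : forall z, 0 <= g z).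
Local Open Scope ereal_scope.

(** Markov's inequality on a disjoint union: a single expectation pays for all the sets at once,
    which is the source of the gain of m^d on average over the boxes. *)
Lemma expectation_ge_disjoint (I : finType) (B : I -> set T) (c : R) :
  (0 <= c)%R -> (forall i, measurable (B i)) -> trivIset setT B ->
  (forall i z, B i z -> c <= g z)%R ->
  c%:E * \sum_i P (B i) <= 'E_P[g].
Proof.
move=> c0 mB tB cg; rewrite [in leRHS]unlock.
have mgE : measurable_fun setT (fun z => (g z)%:E) by exact/measurable_EFinP.
have mD : measurable (\big[setU/set0]_(i : I) B i).
  exact: bigsetU_measurable.
apply: (@le_trans _ _ (\int[P]_(z in \big[setU/set0]_(i : I) B i) (g z)%:E)).
  rewrite ge0_integral_bigsetU ?index_enum_uniq//.
  - rewrite ge0_sume_distrr//; apply: lee_sum => i _.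
    rewrite -integral_cst//; apply: ge0_le_integral => //.
    + exact: measurable_funTS.
    + by move=> z Bz; rewrite lee_fin; exact: cg Bz.
  - exact: sub_trivIset tB.
  - exact: measurable_funTS.
  - by move=> z _; rewrite lee_fin.
by apply: ge0_subset_integral => // z _; rewrite lee_fin.
Qed.

Lemma expectation_ge_set (A : set T) (c : R) :
  (0 <= c)%R -> measurable A -> (forall z, A z -> c <= g z)%R ->
  c%:E * P A <= 'E_P[g].
Proof.
move=> c0 mA cg.
have := @expectation_ge_disjoint 'I_1 (fun=> A) c c0 (fun=> mA) _ (fun=> cg).
by rewrite big_ord1; apply => i j _ _ _; rewrite (ord1 i) (ord1 j).
Qed.

End expectation_lower_bound.

(** * Squared error and the grid of boxes in the ball *)

Section squared_error.
Context (R : realType) (d : nat).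
Implicit Types x y : d.-tuple R.

Lemma sqr_l2norm x : l2norm x ^+ 2 = \sum_(i < d) tnth x i ^+ 2.
Proof. by rewrite sqr_sqrtr// sumr_ge0// => i _; exact: sqr_ge0. Qed.

Lemma sqr_tnth_le x y i : (tnth y i - tnth x i) ^+ 2 <= l2norm (vsub y x) ^+ 2.
Proof.
rewrite sqr_l2norm (bigD1 i)//= tnth_mktuple lerDl.
by rewrite sumr_ge0// => j _; exact: sqr_ge0.
Qed.

Lemma measurable_sqr_dist (disp : measure_display) (T : measurableType disp)
    (f : T -> d.-tuple R) x : measurable_fun setT f ->
  measurable_fun setT (fun z => l2norm (vsub (f z) x) ^+ 2).
Proof.
move=> /measurable_fun_tnthP mf.
under eq_fun do rewrite sqr_l2norm.
apply: measurable_sum => i; apply: measurable_funX.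
under eq_fun do rewrite tnth_mktuple.
by apply: measurable_funB => //; exact: mf.
Qed.

End squared_error.

Section grid.
Context (R : realType) (d m : nat).
Hypotheses (d0 : (0 < d)%N) (m0 : (0 < m)%N).

Let sqrtd_gt0 : 0 < Num.sqrt d%:R :> R.
Proof. by rewrite sqrtr_gt0 ltr0n. Qed.

(* The mesh is 1 / (2 m sqrt d), so that the grid lies in the cube of
   coordinates [1 / (2 sqrt d), 1 / sqrt d], inside the unit ball. *)
Definition half_mesh : R := (4 * m%:R * Num.sqrt d%:R)^-1.

Definition grid_point (g : {ffun 'I_d -> 'I_m}) : d.-tuple R :=
  [tuple (2 * Num.sqrt d%:R)^-1 + 2 * half_mesh * (g i)%:R | i < d].

(** Open sup-norm balls of radius half the mesh: adjacent boxes touch without meeting, and an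
    estimate outside a box is off by at least [half_mesh] in some coordinate. *)
Definition grid_box (g : {ffun 'I_d -> 'I_m}) : set (d.-tuple R) :=
  [set y | forall i, `|tnth y i - tnth (grid_point g) i| < half_mesh].

Lemma half_mesh_gt0 : 0 < half_mesh.
Proof. by rewrite invr_gt0 !mulr_gt0// ltr0n. Qed.

Lemma half_mesh_sqr : half_mesh ^+ 2 = (16 * d%:R * m%:R ^+ 2)^-1.
Proof.
rewrite /half_mesh exprVn !exprMn sqr_sqrtr ?ler0n//; congr (_^-1).
lra.
Qed.

Lemma half_mesh_scaled : m%:R * half_mesh = (4 * Num.sqrt d%:R)^-1.
Proof.
rewrite /half_mesh (mulrC 4) -mulrA invfM mulrA divff ?mul1r//.
by rewrite pnatr_eq0 -lt0n.
Qed.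

Lemma grid_point_tnth_le (g : {ffun 'I_d -> 'I_m}) i :
  0 <= tnth (grid_point g) i <= (Num.sqrt d%:R)^-1.
Proof.
rewrite tnth_mktuple.
have h0 := half_mesh_gt0; have hm := half_mesh_scaled.
have g0 : 0 <= (g i)%:R :> R by rewrite ler0n.
have gm : (g i)%:R <= m%:R :> R by rewrite ler_nat ltnW.
have s0 : 0 < (Num.sqrt d%:R)^-1 :> R by rewrite invr_gt0.
(* Splitting the inverses leaves the inverse of sqrt d as a common atom, so the bounds become
   linear. *)
rewrite !invfM in hm; rewrite ?invfM.
have gh0 : 0 <= half_mesh * (g i)%:R by rewrite mulr_ge0// ltW.
have ghm : half_mesh * (g i)%:R <= half_mesh * m%:R by rewrite ler_pM2l.
apply/andP; split; lra.
Qed.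

Lemma grid_point_norm_le1 (g : {ffun 'I_d -> 'I_m}) :
  l2norm (grid_point g) <= 1.
Proof.
rewrite -[leRHS]sqrtr1 ler_wsqrtr//.
apply: (@le_trans _ _ (\sum_(i < d) d%:R^-1)).
  apply: ler_sum => i _; have /andP[x0 xd] := grid_point_tnth_le g i.
  rewrite -[in leRHS](@sqr_sqrtr _ d%:R) ?ler0n// -exprVn.
  by rewrite ler_sqr// nnegrE (le_trans x0).
by rewrite sumr_const card_ord -[leLHS]mulr_natl divff// pnatr_eq0 -lt0n.
Qed.

Lemma grid_box_disjoint : trivIset setT grid_box.
Proof.
move=> g g' _ _ [y [yg yg']]; apply/ffunP => i; apply/val_inj/eqP.
have {yg}:= yg i; have {yg'} := yg' i; rewrite !tnth_mktuple !ltr_norml.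
move=> /andP[a b] /andP[a' b']; have h0 := half_mesh_gt0.
have h_lt (k l : 'I_m) : (k < l)%N ->
    half_mesh * (k%:R + 1) <= half_mesh * l%:R.
  by move=> kl; rewrite ler_pM2l// natr1 ler_nat.
rewrite eqn_leq; apply/andP; split; rewrite leqNgt; apply/negP => /h_lt; lra.
Qed.

(** One coordinate suffices: it exceeds 1 / (2 sqrt d) - [half_mesh], and [half_mesh] is at most 1 /
    (4 sqrt d) since m >= 1. *)
Lemma grid_box_norm_ge g y : grid_box g y ->
  (16 * d%:R)^-1 <= l2norm (vsub y [tuple 0 | i < d]) ^+ 2.
Proof.
move=> yg; pose i := Ordinal d0.
apply: le_trans (sqr_tnth_le _ _ i).
have := yg i; rewrite !tnth_mktuple subr0 ltr_norml => /andP[+ _].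
have h0 := half_mesh_gt0; have hm := half_mesh_scaled.
have g0 : 0 <= (g i)%:R :> R by rewrite ler0n.
have m1 : 1 <= m%:R :> R by rewrite ler1n.
have s0 : 0 < (Num.sqrt d%:R)^-1 :> R by rewrite invr_gt0.
have -> : (16 * d%:R)^-1 = ((4 * Num.sqrt d%:R)^-1) ^+ 2 :> R.
  by rewrite exprVn exprMn sqr_sqrtr ?ler0n// -natrX.
rewrite !invfM in hm; rewrite ?invfM.
have gh0 : 0 <= half_mesh * (g i)%:R by rewrite mulr_ge0// ltW.
have hmh : half_mesh <= m%:R * half_mesh by rewrite ler_peMl// ltW.
move=> yi; rewrite ler_sqr ?nnegrE; lra.
Qed.

Lemma grid_boxC_dist_ge g y : ~ grid_box g y ->
  half_mesh ^+ 2 <= l2norm (vsub y (grid_point g)) ^+ 2.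
Proof.
move=> /existsNP[i /negP]; rewrite -leNgt => hi.
apply: le_trans (sqr_tnth_le _ _ i).
by rewrite -[leRHS]real_normK ?num_real// ler_sqr ?nnegrE// ltW// half_mesh_gt0.
Qed.

Lemma measurable_grid_box g : measurable (grid_box g).
Proof.
rewrite (_ : grid_box g = \bigcap_(i in [set: 'I_d])
    [set y | `|tnth y i - tnth (grid_point g) i| < half_mesh]).
  apply: fin_bigcap_measurable => // i _.
  rewrite (_ : [set y | _] = (@tnth d R ^~ i) @^-1`
      (ball (tnth (grid_point g) i) half_mesh)).
    rewrite -[X in measurable X]setTI; apply: measurable_tnth => //.
    exact: measurable_ball.
  by apply/seteqP; split => y /=; rewrite /ball/= distrC.
by apply/seteqP; split => y /= yg; [move=> i _; exact: yg|move=> i; exact: yg].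
Qed.

End grid.

(** * Changing one user's input *)

Section one_user_attack.
Context (disp : measure_display) (T : measurableType disp) (R : realType).
Local Open Scope ereal_scope.

(** The factor [n] is the price of the union bound over the reports on [x0]; the lower bound on the
    other dataset uses only the report of the user holding [x1]. *)
Lemma indistinguishable_report_bound (X : eqType) (eps delta : R) (n : nat)
    (rand : X -> probability T R) (x0 x1 : X) (B : set T) :
  (0 < n)%N -> x0 != x1 -> measurable B ->
  (forall x y : n.-tuple X, neighboring x y ->
    indistinguishable eps delta (shuffled_law rand x) (shuffled_law rand y)) ->
  rand x1 B <= (expR eps * n%:R)%:E * rand x0 B + delta%:E.
Proof.
move=> n0 x01 mB ind; pose i0 := Ordinal n0.
pose x := [tuple if i == i0 then x1 else x0 | i < n].
pose y := [tuple x0 | i < n].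
have xy : neighboring x y.
  rewrite /neighboring -(card1 i0); apply: eq_card => i.
  rewrite !inE !tnth_mktuple; case: (i == i0); last by rewrite eqxx.
  by rewrite eq_sym x01.
have mE : measurable (some_report B : set (n.-tuple T)).
  exact: measurable_some_report.
have := ind _ _ xy; rewrite /indistinguishable ge_max => /andP[hxy _].
have := shuffled_law_some_report_ge rand x i0 mB.
rewrite tnth_mktuple eqxx => /le_trans; apply.
apply: le_trans (hockey_stick_bound eps _ _ mE) _; apply: leeD; last exact: hxy.
rewrite EFinM -muleA; apply: lee_wpmul2l; first by rewrite lee_fin expR_ge0.
apply: le_trans (shuffled_law_some_report_le rand y mB) _.
under eq_bigr do rewrite tnth_mktuple -(fineK (fin_num_measure (rand x0) _ mB)).
rewrite sumEFin sumr_const card_ord.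
rewrite -[in leRHS](fineK (fin_num_measure (rand x0) _ mB)).
by rewrite -EFinM mulr_natl.
Qed.

End one_user_attack.

(** * Trade-off between error and grid size, then the choice of m *)

Lemma l2norm0 (R : realType) (d : nat) : l2norm [tuple (0 : R) | i < d] = 0.
Proof.
by rewrite /l2norm big1 ?sqrtr0// => i _; rewrite tnth_mktuple expr0n.
Qed.

Lemma origin_subproof (R : realType) (d : nat) :
  l2norm [tuple (0 : R) | i < d] <= 1.
Proof. by rewrite l2norm0. Qed.

Definition origin (R : realType) (d : nat) : unit_ball R d :=
  exist (fun x : d.-tuple R => l2norm x <= 1) _ (origin_subproof R d).

(** Excludes the value -oo when the supremum is split into cases. *)
Lemma sup_mse_ge0 (R : realType) (d d' : nat)
    (rand : unit_ball R d -> probability (d'.-tuple R) R)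
    (f : d'.-tuple R -> d.-tuple R) : (0 <= sup_mse rand f)%E.
Proof.
apply: (@le_trans _ _ 'E_(rand (origin R d))[
    (fun z => l2norm (vsub (f z) (val (origin R d))) ^+ 2)%R]%E).
  by apply: expectation_ge0 => z; exact: sqr_ge0.
by apply: ereal_sup_ubound; exists (origin R d).
Qed.

Lemma mse_grid_tradeoff (R : realType) (d d' n m : nat) (eps delta a : R)
    (rand : unit_ball R d -> probability (d'.-tuple R) R)
    (f : d'.-tuple R -> d.-tuple R) :
  (0 < d)%N -> (0 < n)%N -> (0 < m)%N -> delta <= 1 / 2 ->
  (forall x y : n.-tuple (unit_ball R d), neighboring x y ->
    indistinguishable eps delta (shuffled_law rand x) (shuffled_law rand y)) ->
  measurable_fun setT f ->
  (forall x, 'E_(rand x)[(fun z => l2norm (vsub (f z) (val x)) ^+ 2)%R]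
     <= a%:E)%E ->
  m%:R ^+ d <= 32 * d%:R * a * (m%:R ^+ d * m%:R ^+ 2 + expR eps * n%:R).
Proof.
move=> d0 n0 m0 delta_le ind mf mse.
pose x0 := origin R d.
pose x (g : {ffun 'I_d -> 'I_m}) : unit_ball R d :=
  exist (fun x : d.-tuple R => l2norm x <= 1) _ (grid_point_norm_le1 R d0 m0 g).
pose B (g : {ffun 'I_d -> 'I_m}) := f @^-1` grid_box g.
have mB g : measurable (B g).
  by rewrite -[B g]setTI; apply: mf => //; exact: measurable_grid_box.
(* The datasets must really differ: the box of [g] contains its centre but stays away from the
   origin. *)
have x0g g : x0 != x g.
  apply/eqP => /(congr1 (@sval _ _)) /= e.
  have gg : grid_box g (grid_point R g).
    by move=> i; rewrite subrr normr0 half_mesh_gt0.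
  have := grid_box_norm_ge d0 m0 gg; rewrite -e sqr_l2norm big1 => [|i _].
    by rewrite leNgt invr_gt0 mulr_gt0// ltr0n.
  by rewrite !tnth_mktuple subrr expr0n.
have msq x' := measurable_sqr_dist x' mf.
have sq0 (x' : d.-tuple R) z : 0 <= l2norm (vsub (f z) x') ^+ 2.
  exact: sqr_ge0.
pose p g := fine (rand (x g) (B g)).
pose q g := fine (rand x0 (B g)).
have pE g : rand (x g) (B g) = (p g)%:E by rewrite fineK// fin_num_measure.
have qE g : rand x0 (B g) = (q g)%:E by rewrite fineK// fin_num_measure.
have q_sum : (16 * d%:R)^-1 * \sum_g q g <= a.
  rewrite -lee_fin EFinM -sumEFin.
  under eq_bigr do rewrite -qE.
  apply: le_trans (mse x0); apply: expectation_ge_disjoint => //.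
  - by move=> g g' _ _ [z [/= zg zg']];
      apply: (grid_box_disjoint d0 m0) => //; exists (f z).
  - by move=> g z; exact: grid_box_norm_ge.
have p_ge g : (@half_mesh R d m) ^+ 2 * (1 - p g) <= a.
  rewrite -lee_fin EFinM EFinB -pE -probability_setC//.
  apply: le_trans (mse (x g)); apply: expectation_ge_set => //.
  - exact: sqr_ge0.
  - exact: measurableC.
  - by move=> z; exact: grid_boxC_dist_ge.
have pq g : p g <= expR eps * n%:R * q g + delta.
  rewrite -lee_fin EFinD EFinM -pE -qE.
  exact: indistinguishable_report_bound.
have dR : 0 < d%:R :> R by rewrite ltr0n.
have mR : 0 < m%:R :> R by rewrite ltr0n.
(* Here 1/2 <= 1 - delta, and [p_ge] bounds the miss probability 1 - [p g] by a / [half_mesh]^2 = 16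
   d m^2 a. *)
have step g : 1 / 2 <= 16 * d%:R * m%:R ^+ 2 * a + expR eps * n%:R * q g.
  have := p_ge g; rewrite half_mesh_sqr -ler_pdivlMl ?invr_gt0 ?invrK.
    by have := pq g; lra.
  by rewrite !mulr_gt0// exprn_gt0.
(* There are m^d indices, and [q_sum] bounds the total of the [q g] by 16 d a; doubling to clear the
   1/2 gives the constant 32. *)
have : \sum_(g : {ffun 'I_d -> 'I_m}) (1 / 2 : R) <=
    \sum_g (16 * d%:R * m%:R ^+ 2 * a + expR eps * n%:R * q g).
  by apply: ler_sum.
rewrite big_split/= -[X in _ + X]mulr_sumr !sumr_const card_ffun !card_ord.
rewrite -(mulr_natr (1/2)) -(mulr_natr (16 * _ * _ * _)) natrX.
move: q_sum; rewrite ler_pdivrMl ?mulr_gt0// => q_sum.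
have : expR eps * n%:R * \sum_g q g <= expR eps * n%:R * (16 * d%:R * a).
  by rewrite ler_wpM2l// mulr_ge0// expR_ge0.
lra.
Qed.

Theorem theorem6p2 (R : realType) (d : nat) (eps delta : R) :
  (0 < d)%N -> 0 < eps -> 0 < delta -> delta <= 1 / 2 ->
  exists (c k : R) (n0 : nat), [/\ 0 < c, 0 <= k &
    forall (n d' : nat), (n0 <= n)%N -> (0 < d')%N ->
    forall rand : unit_ball R d -> probability (d'.-tuple R) R,
      (forall X X' : n.-tuple (unit_ball R d), neighboring X X' ->
        indistinguishable eps delta
          (shuffled_law rand X) (shuffled_law rand X')) ->
    forall f : d'.-tuple R -> d.-tuple R, measurable_fun setT f ->
      ((c * (1 / n%:R `^ (2 / (d%:R + 2))) / ln n%:R `^ k)%:E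
         <= sup_mse rand f)%E].
Proof.
move=> d0 eps0 delta0 delta_le.
have dR : 0 < d%:R :> R by rewrite ltr0n.
have e0 := expR_gt0 eps.
(* The 4 comes from m <= 2t below, squared, and e^eps from the term in n. With k = 0 the logarithmic
   factor is 1, even at n = 1 where the logarithm vanishes. *)
exists (32 * d%:R * (4 + expR eps))^-1, 0, 1%N; split => //.
  by rewrite invr_gt0 !mulr_gt0// addr_gt0.
move=> n d' n0 _ rand ind f mf; rewrite powRr0 divr1.
have mse x : ('E_(rand x)[(fun z => l2norm (vsub (f z) (val x)) ^+ 2)%R]
    <= sup_mse rand f)%E by apply: ereal_sup_ubound; exists x.
have := sup_mse_ge0 rand f.
move: mse; case: (sup_mse rand f) => [a|_ _|//]; last exact: leey.
move=> mse; rewrite !lee_fin => a0.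
(* The balance point of m^2 and n / m^d, since t^d t^2 = n. *)
pose t : R := n%:R `^ (d%:R + 2)^-1.
have n1 : 1 <= n%:R :> R by rewrite ler1n.
have t1 : 1 <= t.
  by rewrite -(powRr0 n%:R) ler_powR// invr_ge0 addr_ge0.
have t2 : n%:R `^ (2 / (d%:R + 2)) = t ^+ 2.
  by rewrite mulrC powRrM powR_mulrn// powR_ge0.
have td : n%:R = t ^+ d * t ^+ 2.
  rewrite -exprD -powR_mulrn ?powR_ge0// -powRrM natrD.
  by rewrite mulVf ?powRr1// lt0r_neq0// addr_gt0.
(* Rounding up gives t <= m, needed for n <= m^d t^2; the overshoot is at most 1 <= t, so m <=
   2t. *)
pose m := (Num.trunc t).+1.
have tm : t <= m%:R by rewrite ltW// truncnS_gt.
have mt : m%:R <= 2 * t.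
  have : (Num.trunc t)%:R <= t by rewrite truncn_le (le_trans _ t1).
  by rewrite /m -natr1; lra.
have := mse_grid_tradeoff d0 n0 (ltn0Sn (Num.trunc t)) delta_le ind mf mse.
rewrite -/m => H.
have t0 : 0 < t by rewrite (lt_le_trans ltr01).
have mR : 0 < m%:R :> R by rewrite ltr0n.
have mmt : m%:R ^+ 2 <= 4 * t ^+ 2.
  by rewrite -[4]/(2 ^ 2)%:R natrX -exprMn ler_sqr ?nnegrE// mulr_ge0// ltW.
have ntm : n%:R <= m%:R ^+ d * t ^+ 2.
  by rewrite td ler_wpM2r ?sqr_ge0// lerXn2r ?nnegrE// ltW.
(* Both terms of the trade-off are now at most m^d times a multiple of t^2, so m^d cancels. *)
have {H} : m%:R ^+ d * 1 <=
    m%:R ^+ d * (32 * d%:R * a * ((4 + expR eps) * t ^+ 2)).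
  rewrite mulr1; apply: le_trans H _.
  rewrite [leRHS]mulrCA ler_wpM2l ?mulr_ge0//.
  rewrite mulrDl mulrDr lerD//; last by rewrite mulrCA ler_wpM2l// ltW.
  by rewrite ler_wpM2l// exprn_ge0// ltW.
rewrite ler_pM2l ?exprn_gt0// t2 => H.
rewrite mul1r ler_pdivrMl ?mulr_gt0 ?addr_gt0//.
by rewrite -[leLHS]mul1r ler_pdivrMr ?exprn_gt0//; lra.
Qed.
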